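(* Let $X$ be a zero-dimensional compact Hausdorff space. Then the Banach algebra $C(X)$ (of real-valued or of complex-valued continuous functions on $X$) has uniformly open multiplication.
   Context: $C(X)$ carries pointwise operations and the supremum norm. $X$ is zero-dimensional if it has a base consisting of closed-and-open sets. A Banach algebra $A$ has uniformly open multiplication if for every $\varepsilon>0$ there is $\delta>0$ such that for all $x,y\in A$ one has $B(xy,\delta)\subseteq B(x,\varepsilon)\cdot B(y,\varepsilon)$, where $B(x,r)$ is the open ball with centre $x$ and radius $r$ and $U\cdot V=\{uv\colon u\in U,v\in V\}$. *)

(* Defs.v *)
From HB Require Import structures.
From mathcomp Require Import all_boot all_order all_algebra.
From mathcomp Require Import complex.
From mathcomp Require Import all_classical all_reals.
From mathcomp Require Import topology normedtype.

Set Implicit Arguments.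
Unset Strict Implicit.
Unset Printing Implicit Defensive.

Import Order.TTheory GRing.Theory Num.Theory.
Import numFieldNormedType.Exports.

Local Open Scope classical_set_scope.
Local Open Scope ring_scope.

(* This is not the library's [zero_dimensional], which only asks that distinct
   points be separated by a clopen set. *)
Definition has_clopen_basis (X : topologicalType) : Prop :=
  exists2 B : set (set X), basis B & B `<=` clopen.

(* C(X, K), with K carrying the topology of its absolute value.  X may be empty,
   in which case C(X, K) is the zero ring; hence the use of [comPzRingType]. *)
Definition contfun (X : topologicalType) (K : numFieldType) : Type :=
  continuousType X K.

Section ContfunRing.
Context {X : topologicalType} {K : numFieldType}.

Definition contfun_pred : {pred X -> K} := mem [set f : X -> K | continuous f].

Definition contfun_val (f : contfun X K) : X -> K := f.

Definition contfun_sub (f : X -> K) (fP : f \in contfun_pred) : contfun X K :=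
  HB.pack f (@isContinuous.Build X K f (set_mem fP)).

Lemma contfun_rect (T : contfun X K -> Type) :
  (forall f (fP : f \in contfun_pred), T (contfun_sub fP)) -> forall u, T u.
Proof.
move=> Tsub [f [[fc]]].
by have -> : fc = set_mem (mem_set fc : f \in contfun_pred) by []; exact: Tsub.
Qed.

Lemma contfun_subK f (fP : f \in contfun_pred) :
  contfun_val (contfun_sub fP) = f.
Proof. by []. Qed.

HB.instance Definition _ := isSub.Build (X -> K) contfun_pred (contfun X K)
  contfun_rect contfun_subK.
HB.instance Definition _ := [Choice of contfun X K by <:].

Lemma contfun_subring_closed : subring_closed contfun_pred.
Proof.
split=> [|f g|f g]; rewrite !inE/=.
- by move=> x; exact: cvg_cst.
- by move=> fc gc x; apply: cvgB; [exact: fc|exact: gc].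
- by move=> fc gc x; apply: cvgM; [exact: fc|exact: gc].
Qed.

HB.instance Definition _ :=
  GRing.isSubringClosed.Build _ contfun_pred contfun_subring_closed.
HB.instance Definition _ := GRing.SubChoice_isSubComPzRing.Build _ _ (contfun X K)
    (GRing.subringClosedP contfun_pred).

Lemma contfun_scale_subproof (a : K) (f : contfun X K) :
  (fun x => a * contfun_val f x) \in contfun_pred.
Proof.
rewrite inE/= => x.
by apply: cvgM; [exact: cvg_cst|exact: (@cts_fun X K f)].
Qed.

Definition contfun_scale (a : K) (f : contfun X K) : contfun X K :=
  contfun_sub (contfun_scale_subproof a f).

Fact contfun_scaleA a b f :
  contfun_scale a (contfun_scale b f) = contfun_scale (a * b) f.
Proof. by apply/val_inj/funext => x; rewrite /= mulrA. Qed.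

Fact contfun_scale1 : left_id 1 contfun_scale.
Proof. by move=> f; apply/val_inj/funext => x; rewrite /= mul1r. Qed.

Fact contfun_scaleDr : right_distributive contfun_scale +%R.
Proof. by move=> a f g; apply/val_inj/funext => x; rewrite /= mulrDr. Qed.

Fact contfun_scaleDl f : {morph contfun_scale^~ f : a b / a + b}.
Proof. by move=> a b; apply/val_inj/funext => x; rewrite /= mulrDl. Qed.

HB.instance Definition _ := GRing.Zmodule_isLmodule.Build K (contfun X K)
  contfun_scaleA contfun_scale1 contfun_scaleDr contfun_scaleDl.

End ContfunRing.

Coercion contfun_val : contfun >-> Funclass.

Section ContfunTheory.
Context {X : topologicalType} {K : numFieldType}.
Implicit Types f g : contfun X K.

Lemma contfun_continuous f : continuous (f : X -> K).
Proof. exact: (@cts_fun X K f). Qed.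

Lemma contfunP f g : f = g <-> forall x, f x = g x.
Proof. by split=> [->//|fg]; apply/val_inj/funext. Qed.

Lemma contfun0E x : (0 : contfun X K) x = 0. Proof. by []. Qed.
Lemma contfun1E x : (1 : contfun X K) x = 1. Proof. by []. Qed.
Lemma contfunNE f x : (- f) x = - f x. Proof. by []. Qed.
Lemma contfunDE f g x : (f + g) x = f x + g x. Proof. by []. Qed.
Lemma contfunBE f g x : (f - g) x = f x - g x. Proof. by []. Qed.
Lemma contfunME f g x : (f * g) x = f x * g x. Proof. by []. Qed.
Lemma contfunZE a f x : (a *: f) x = a * f x. Proof. by []. Qed.

End ContfunTheory.

(* The absolute value [abs] is a parameter because the norm of [R[i]] as a
   [numFieldType] takes its values in [R[i]] and not in [R].  On compact X the
   range is bounded; for empty X the supremum is 0. *)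
Definition sup_norm (R : realType) (X : topologicalType) (K : numFieldType)
    (abs : K -> R) (f : contfun X K) : R :=
  sup [set abs (f x) | x in [set: X]].

Definition real_sup_norm (R : realType) (X : topologicalType) :
    contfun X R -> R :=
  sup_norm (fun a : R => `|a|).

Definition complex_sup_norm (R : realType) (X : topologicalType) :
    contfun X R[i] -> R :=
  sup_norm (@Normc.normc R).

Section UniformlyOpen.
Context {R : realType} {A : pzRingType} (nrm : A -> R).

Definition oball (x : A) (r : R) : set A := [set z | nrm (z - x) < r].

Definition set_prod (U V : set A) : set A := [set u * v | u in U & v in V].

Definition uniformly_open_mul : Prop :=
  forall eps : R, 0 < eps -> exists2 delta : R, 0 < delta &
    forall x y : A,
      oball (x * y) delta `<=` set_prod (oball x eps) (oball y eps).

End UniformlyOpen.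

(* Main.v *)
Require Import Defs.
From mathcomp Require Import all_boot all_order all_algebra.
From mathcomp Require Import complex lra.
From mathcomp Require Import all_classical all_reals.
From mathcomp Require Import topology normedtype.

(** If [|x|] is bounded below, then [x * (z / x)] factors [z] with both factors
    close to [x] and [y]; symmetrically if [|y|] is bounded below; and where both
    [x] and [y] are of order [eps], so is [z / eps], hence [c * (z / c)] works
    for a constant [c] of order [eps].  In a zero-dimensional compact space the
    open conditions choosing between the three cases can be refined to clopen
    ones, on which the piecewise defined factors are continuous. *)

Set Implicit Arguments.
Unset Strict Implicit.
Unset Printing Implicit Defensive.

Import Order.TTheory GRing.Theory Num.Theory.
Import numFieldNormedType.Exports.
Local Open Scope classical_set_scope.
Local Open Scope ring_scope.

(* Near-covering compactness is applied along the clopen subsets of [F] ordered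
   by inclusion. *)
Lemma clopen_between {X : topologicalType} (F G : set X) :
  compact [set: X] -> has_clopen_basis X -> open F -> open G ->
  [set: X] `<=` F `|` G ->
  exists C : set X, [/\ clopen C, C `<=` F & ~` C `<=` G].
Proof.
move=> /compact_near_coveringP covX [B [Bopen Bnbhs] Bclopen] oF oG FG.
pose D := [set V : set X | clopen V /\ V `<=` F].
pose Fil := filter_from D (fun V => [set W | D W /\ V `<=` W]).
have FilF : Filter Fil.
  apply: filter_from_filter.
    by exists set0; split=> //; exact: clopen0.
  move=> V W [cV VF] [cW WF]; exists (V `|` W).
    by split; [exact: clopenU | rewrite subUset].
  by move=> U [DU]; rewrite subUset => -[].
(* Near-covering yields one clopen [V] inside [F] such that every clopen [W] with [V <= W <= F]
   covers [X] together with [G]; the choice [W = V] puts the complement of [V] inside [G]. *)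
have [x _|V [cV VF] sub] := covX _ Fil (fun V x => V x \/ G x) FilF; last first.
  have VUG : [set: X] `<=` V `|` G by apply: sub; split.
  by exists V; split=> // x nVx; have [//|] := VUG x I.
have [Fx|Gx] := FG x I.
  have [U [BU Ux] UF] : filter_from [set U | B U /\ U x] id F.
    by apply: Bnbhs; exact: open_nbhs_nbhs.
  exists (U, [set W | D W /\ U `<=` W]).
    split; first by apply: open_nbhs_nbhs; split=> //; exact: Bopen.
    by exists U => //; split=> //; exact: Bclopen.
  by move=> [y W] [/= Uy [_ UW]]; left; exact: UW.
exists (G, setT).
  by split; [exact: open_nbhs_nbhs | exact: filterT].
by move=> [y W] [/= Gy _]; right.
Qed.

(** Both [C] and its complement are open, so near each point only one branch is used. Continuity is
    asked of a branch only on its own piece, which admits quotients whose denominator vanishes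
    elsewhere. *)
Lemma continuous_piecewise {X Y : topologicalType} (C : set X) (f g : X -> Y) :
  clopen C -> {in C, continuous f} -> {in ~` C, continuous g} ->
  continuous (fun x => if x \in C then f x else g x).
Proof.
move=> [oC cC] fc gc x; have [xC|xC] := boolP (x \in C).
  rewrite /continuous_at xC; apply: cvg_trans (fc x xC).
  apply: near_eq_cvg; near=> y.
  have Cy : C y by near: y; apply: open_nbhs_nbhs; split=> //; exact: set_mem.
  by rewrite mem_set.
have xC' : x \in ~` C by rewrite in_setC.
rewrite /continuous_at (negbTE xC); apply: cvg_trans (gc x xC').
apply: near_eq_cvg; near=> y.
have Cy : (~` C) y.
  by near: y; apply: open_nbhs_nbhs; split; [exact: closed_openC|exact: set_mem].
by rewrite memNset.
Unshelve. all: by end_near. Qed.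

Lemma contfun_piecewise {X : topologicalType} {K : numFieldType} (C : set X)
    (f g : X -> K) :
  clopen C -> {in C, continuous f} -> {in ~` C, continuous g} ->
  exists u : contfun X K, forall x, u x = if x \in C then f x else g x.
Proof.
move=> cC fc gc.
by exists (contfun_sub (mem_set (continuous_piecewise cC fc gc))).
Qed.

(** Real and complex scalars are treated at once: [iota] embeds [R] in [K], and facts about the
    [K]-valued norm are pulled back along it to [abs]. *)
Section AbsoluteValue.
Context {R : realType} {K : numFieldType} {abs : K -> R}.
Context {iota : {rmorphism R -> K}}.
Hypothesis iota_le : {mono iota : a b / a <= b}.
Hypothesis normE : forall a, `|a| = iota (abs a).

Let iota_lt : {mono iota : a b / a < b}. Proof. exact: leW_mono. Qed.

Let iota_inj : injective iota. Proof. exact: inc_inj iota_le. Qed.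

Lemma abs_ge0 a : 0 <= abs a.
Proof. by rewrite -iota_le rmorph0 -normE. Qed.

Lemma abs0 : abs 0 = 0.
Proof. by apply: iota_inj; rewrite -normE normr0 rmorph0. Qed.

Lemma absM a b : abs (a * b) = abs a * abs b.
Proof. by apply: iota_inj; rewrite rmorphM -!normE normrM. Qed.

Lemma ler_absB a b : abs (a - b) <= abs a + abs b.
Proof. by rewrite -iota_le rmorphD -!normE ler_normB. Qed.

Lemma ler_abs_dist a b : abs a <= abs (a - b) + abs b.
Proof. by rewrite -iota_le rmorphD -!normE -{1}(subrK b a) ler_normD. Qed.

Lemma abs_iota t : 0 <= t -> abs (iota t) = t.
Proof.
by move=> t0; apply: iota_inj; rewrite -normE ger0_norm// -[leLHS](rmorph0 iota) iota_le.
Qed.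

Lemma abs_gt0_neq0 a (t : R) : 0 <= t -> t < abs a -> a != 0.
Proof.
by move=> t0 ta; apply/eqP => a0; move: ta; rewrite a0 abs0 ltNge t0.
Qed.

(** Relates the error of a quotient to that of a product, multiplied out so that a lower bound on
    [abs a] can be fed to [nra]. *)
Lemma abs_divB (a b c : K) : a != 0 -> abs (c / a - b) * abs a = abs (c - a * b).
Proof. by move=> a0; rewrite -absM mulrBl divfK// [b * a]mulrC. Qed.

(** By the reverse triangle inequality [abs] is 1-Lipschitz; balls of [K] have radii in [K], hence
    [iota e]. *)
Lemma abs_continuous : continuous abs.
Proof.
move=> a; apply/(@cvgrPdist_lt _ _ _ (nbhs a)) => e e0.
have : \forall b \near a, `|a - b| < iota e.
  apply/nbhs_ballP; exists (iota e) => //=.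
  by rewrite -[ltLHS](rmorph0 iota) iota_lt.
apply: filterS => b; rewrite normE iota_lt; apply: le_lt_trans.
have absB x y : abs x - abs y <= abs (x - y).
  by rewrite lerBlDr ler_abs_dist.
have absBC : abs (b - a) = abs (a - b) by apply: iota_inj; rewrite -!normE distrC.
by rewrite ler_norml; have := absB a b; have := absB b a; rewrite absBC; lra.
Qed.

Context {X : topologicalType}.
Implicit Types f x y z u v : contfun X K.

Lemma abs_contfun_continuous f : continuous (abs \o f).
Proof.
by move=> p; apply: continuous_comp; [exact: contfun_continuous|exact: abs_continuous].
Qed.

Lemma sup_norm_ubound f p : compact [set: X] -> abs (f p) <= sup_norm abs f.
Proof.
move=> cX; apply: ub_le_sup; last by exists p.
have : bounded_set ((abs \o f) @` [set: X]).
  apply/compact_bounded/continuous_compact => //.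
  exact/continuous_subspaceT/abs_contfun_continuous.
case=> M [_ /(_ (M + 1))]; rewrite ltrDl ltr01 => /(_ isT) bM.
by exists (M + 1) => _ [q _ <-]; rewrite (le_trans (ler_norm _))//; apply: bM; exists q.
Qed.

(** The condition [0 <= t] serves the empty space, where the supremum is 0. *)
Lemma sup_norm_le f (t : R) : 0 <= t -> (forall p, abs (f p) <= t) ->
  sup_norm abs f <= t.
Proof.
move=> t0 ft; rewrite /sup_norm; have [->|/set0P ne] := eqVneq [set abs (f x) | x in [set: X]] set0.
  by rewrite sup0.
by apply: ge_sup => // _ [p _ <-].
Qed.

(** Since [s < t], the open conditions [s < abs (f p)] and [abs (f p) < t] cover [X]. *)
Lemma clopen_abs f (s t : R) : compact [set: X] -> has_clopen_basis X -> s < t ->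
  exists C : set X,
    [/\ clopen C, forall p, C p -> s < abs (f p) & forall p, ~ C p -> abs (f p) < t].
Proof.
move=> cX zX st.
have opre D : open D -> open ((abs \o f) @^-1` D).
  by apply: open_comp => p _; exact: abs_contfun_continuous.
have [||p _|C [cC sC tC]] := clopen_between
    (F := [set p | s < abs (f p)]) (G := [set p | abs (f p) < t]) cX zX.
- exact: (opre [set r | s < r] (@open_gt R s)).
- exact: (opre [set r | r < t] (@open_lt R t)).
- by have [sf|fs] := ltP s (abs (f p)); [left|right; exact: le_lt_trans st].
- by exists C.
Qed.

Lemma contfun_div_continuous f g p :
  (g : contfun X K) p != 0 -> {for p, continuous (fun q => f q / g q)}.
Proof.
move=> gp; apply: cvgM; first exact: contfun_continuous.
by apply: cvgV => //; exact: contfun_continuous.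
Qed.

Lemma contfun_uniformly_open : compact [set: X] -> has_clopen_basis X ->
  uniformly_open_mul (@sup_norm R X K abs).
Proof.
(* Pointwise errors will be at most [5 * h]; a pointwise bound passes to the supremum only as a weak
   inequality, so [eps] must exceed [5 * h]. *)
move=> cX zX eps eps0; pose h := eps / 8.
have h0 : 0 < h by rewrite /h; lra.
exists (h * h) => [|x y z zxy]; first exact: mulr_gt0.
have {}zxy p : abs (z p - x p * y p) < h * h.
  exact: le_lt_trans (sup_norm_ubound (z - x * y) p cX) zxy.
have h2 : h < 2 * h by lra.
have [C1 [cC1 C1x xC1]] := clopen_abs x cX zX h2.
have [C2 [cC2 C2y yC2]] := clopen_abs y cX zX h2.
have x0 p : C1 p -> x p != 0 by move=> /C1x; exact/abs_gt0_neq0/ltW.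
have y0 p : C2 p -> y p != 0 by move=> /C2y; exact/abs_gt0_neq0/ltW.
pose c := iota (3 * h).
have absc : abs c = 3 * h by rewrite abs_iota//; lra.
have c0 : c != 0 by apply: (@abs_gt0_neq0 _ 0); rewrite ?absc; lra.
have zc0 : continuous (fun p => z p / c).
  by move=> p; apply: cvgM; [exact: contfun_continuous|exact: cvg_cst].
(* [u2] and [v2] settle the last two cases; [u] and [v] then give [C1] priority where it meets
   [C2]. *)
have [u2 u2E] : exists u : contfun X K, forall p, u p = if p \in C2 then z p / y p else c.
  apply: contfun_piecewise => // p; last by move=> _; exact: cvg_cst.
  by move=> /set_mem/y0; exact: contfun_div_continuous.
have [v2 v2E] : exists v : contfun X K, forall p, v p = if p \in C2 then y p else z p / c.
  by apply: contfun_piecewise => // p _; exact: contfun_continuous.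
have [u uE] : exists u : contfun X K, forall p, u p = if p \in C1 then x p else u2 p.
  by apply: contfun_piecewise => // p _; exact: contfun_continuous.
have [v vE] : exists v : contfun X K, forall p, v p = if p \in C1 then z p / x p else v2 p.
  apply: contfun_piecewise => // p; last by move=> _; exact: contfun_continuous.
  by move=> /set_mem/x0; exact: contfun_div_continuous.
(* The error is in fact below [h * h / h = h]; it is weakened to the bound of the third case. *)
have close (a b d : K) : h < abs a -> abs (d - a * b) < h * h ->
    abs (d / a - b) <= 5 * h.
  move=> ha; have a0 : a != 0 by exact: abs_gt0_neq0 (ltW h0) ha.
  rewrite -abs_divB// => dab.
  have := abs_ge0 (d / a - b); nra.
have bounds p : [/\ u p * v p = z p, abs (u p - x p) <= 5 * h & abs (v p - y p) <= 5 * h].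
  have zp := zxy p.
  rewrite uE vE; case: ifPn => [/set_mem C1p|/negP nC1].
    split; first by rewrite mulrC divfK// x0.
      by rewrite subrr abs0; lra.
    by apply: close => //; exact: C1x.
  have {nC1}/xC1 xp : ~ C1 p by move=> /mem_set.
  rewrite u2E v2E; case: ifPn => [/set_mem C2p|/negP nC2].
    split; first by rewrite divfK// y0.
      by apply: close; [exact: C2y|rewrite mulrC].
    by rewrite subrr abs0; lra.
  have {nC2}/yC2 yp : ~ C2 p by move=> /mem_set.
  split; first by rewrite mulrC divfK.
    (* Here [abs c + abs (x p) < 3 * h + 2 * h], the source of the factor 5. *)
    by have := ler_absB c (x p); rewrite absc; lra.
  (* Now [abs (z p) < h * h + (2 * h) * (2 * h)], so [z p / c] is below [5 * h / 3], and adding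
     [abs (y p) < 2 * h] stays under [5 * h]. *)
  have zB : abs (z p) <= abs (z p - x p * y p) + abs (x p) * abs (y p).
    by rewrite -absM; exact: ler_abs_dist.
  have zcE : abs (z p / c) * (3 * h) = abs (z p) by rewrite -absc -absM divfK.
  have := ler_absB (z p / c) (y p).
  have := abs_ge0 (x p); have := abs_ge0 (y p); nra.
have ball (f g : contfun X K) : (forall p, abs (f p - g p) <= 5 * h) -> oball (sup_norm abs) g eps f.
  move=> fg; apply: (@le_lt_trans _ _ (5 * h)); last by rewrite /h; lra.
  by apply: sup_norm_le => //; lra.
exists u; first by apply: ball => p; have [] := bounds p.
exists v; first by apply: ball => p; have [] := bounds p.
by apply/contfunP => p; have [] := bounds p.
Qed.

End AbsoluteValue.

Theorem proposition4p6 (R : realType) (X : topologicalType)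
    (compactX : compact [set: X]%classic) (hausdorffX : hausdorff_space X)
    (zeroX : has_clopen_basis X) :
  uniformly_open_mul (@real_sup_norm R X) /\
  uniformly_open_mul (@complex_sup_norm R X).
Proof.
split.
- by apply: (@contfun_uniformly_open R R _ idfun).
- by apply: (@contfun_uniformly_open R R[i] _ (real_complex R)) => // a b; exact: lecR.
Qed.
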